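(* Let $a>0$, $0<t<1$ and $p>0$, and for $s>0$ let $$A_s(z)=\frac{(z+st(1-t))\left(z^2+(1-t)(a(1-t)+(s+p)t)z+ast(1-t)^3\right)}{z^2}.$$ Then for each $s>0$ we have $\Gamma_1(s)\subset(0,\infty)$ and $\Gamma_2(s)\subset(-\infty,-\frac{p^2t^2}{4a}]$. More precisely, there exist $\eta(s)<0<\beta(s)<\gamma(s)$ such that $$\Gamma_1(s)=[\beta(s),\gamma(s)],\qquad \Gamma_2(s)=(-\infty,\eta(s)].$$ In addition: (a) $s\mapsto\gamma(s)$ is strictly increasing for $s>0$, $\lim_{s\to0+}\gamma(s)=(1-t)(a(1-t)+pt)$ and $\lim_{s\to\infty}\gamma(s)=\infty$; (b) $s\mapsto\beta(s)$ is positive and strictly decreasing for $s>0$ with $\lim_{s\to0+}\beta(s)=(1-t)(a(1-t)+pt)$ and $\lim_{s\to\infty}\beta(s)=0$; (c) $s\mapsto\eta(s)$ is negative and strictly decreasing for $s>0$ with $\lim_{s\to0+}\eta(s)=-\frac{p^2t^2}{4a}$ and $\lim_{s\to\infty}\eta(s)=-\infty$.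
   Context: For $x\in\mathbb{C}$ and $s>0$, let $z_1(x,s),z_2(x,s),z_3(x,s)$ be the three solutions (counted with multiplicity) of the equation $A_s(z)=x$, labelled so that $|z_1(x,s)|\ge|z_2(x,s)|\ge|z_3(x,s)|>0$. Define $$\Gamma_1(s)=\{x\in\mathbb{C}:|z_1(x,s)|=|z_2(x,s)|\},\qquad \Gamma_2(s)=\{x\in\mathbb{C}:|z_2(x,s)|=|z_3(x,s)|\}.$$ *)

(* Defs.v *)
From HB Require Import structures.
From mathcomp Require Import all_boot all_order all_algebra.
From mathcomp Require Import complex.
From mathcomp Require Import all_classical all_reals all_analysis.

Set Implicit Arguments.
Unset Strict Implicit.
Unset Printing Implicit Defensive.

Import Order.TTheory GRing.Theory Num.Theory.
Import numFieldNormedType.Exports.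

Local Open Scope classical_set_scope.
Local Open Scope ring_scope.
Local Open Scope complex_scope.

(* Meaningful for z != 0 only; every use below assumes z != 0. *)
Definition A (R : realType) (a t p s : R) (z : R[i]) : R[i] :=
  (z + (s * t * (1 - t))%:C)
  * (z ^+ 2 + ((1 - t) * (a * (1 - t) + (s + p) * t))%:C * z
     + (a * s * t * (1 - t) ^+ 3)%:C)
  / z ^+ 2.

(* z1, z2, z3 list the solutions of A_s(z) = x with multiplicity, in order of
   nonincreasing modulus. The product formula encodes the multiplicities:
   z ^+ 2 * (A_s(z) - x) is a monic cubic in z, and z ^+ 2 has no zero on the
   domain z != 0 of A_s. The order relations are those of R[i], where u <= v
   means that v - u is real and nonnegative, and `|z| is real. *)
Definition ordered_solutions (R : realType) (a t p s : R)
    (x z1 z2 z3 : R[i]) : Prop :=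
  [/\ forall z : R[i], z != 0 ->
        A a t p s z - x = (z - z1) * (z - z2) * (z - z3) / z ^+ 2,
      `|z2| <= `|z1|, `|z3| <= `|z2| & 0 < `|z3|].

(* The solutions are determined by x up to order, so their ordered moduli do
   not depend on the choice of labels and the existential is harmless. *)
Definition Gamma1 (R : realType) (a t p s : R) : set R[i] :=
  [set x | exists z1 z2 z3 : R[i],
     ordered_solutions a t p s x z1 z2 z3 /\ `|z1| = `|z2|].

Definition Gamma2 (R : realType) (a t p s : R) : set R[i] :=
  [set x | exists z1 z2 z3 : R[i],
     ordered_solutions a t p s x z1 z2 z3 /\ `|z2| = `|z3|].

(* A set of reals viewed as a subset of the complex plane. *)
Definition inC (R : realType) (S : set R) : set R[i] :=
  [set r%:C | r in S].

(* Main.v *)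
Require Import Defs.
From HB Require Import structures.
From mathcomp Require Import all_boot all_order all_algebra.
From mathcomp Require Import complex.
From mathcomp Require Import all_classical all_reals all_analysis.
From mathcomp Require Import ring lra.

Set Implicit Arguments.
Unset Strict Implicit.
Unset Printing Implicit Defensive.

Import Order.TTheory GRing.Theory Num.Theory.
Import numFieldNormedType.Exports.

Local Open Scope classical_set_scope.
Local Open Scope ring_scope.
Local Open Scope complex_scope.

(** Put [al = a (1 - t)^2], [q = (1 - t) p t] and [b = s t (1 - t)], so that [s]
    enters through [b] alone; the lemmas on the real symbol write [a] for
    [al]. With [k = 1 + b / z] the symbol factors as
    [A_s(z) = k^2 (z + al) + q k], and [z^2 (A_s(z) - x)] is the cubic
    [z^3 + (B - x) z^2 + C z + D] with [B = al + 2 b + q],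
    [C = b^2 + 2 al b + q b] and [D = al b^2].

    The critical points of [A_s] are the roots of [z^3 = C z + 2 D]. The sign
    changes of this cubic place them at [-n < -b < -m < 0 < m + n]
    ([exists_critical]); therefore [C = m^2 + m n + n^2] and
    [2 D = m n (m + n)], and in particular [27 D^2 < C^3].

    Let [z, w] be two of the solutions of [A_s(z) = x], with common squared
    modulus [rho], and let [v] be the third. Eliminating [v] and [x] from
    Vieta's relations, and comparing with the conjugate equation, leaves two
    cases: [z w = rho], or a case that forces [C^3 <= 27 D^2]. So [w] is the
    conjugate of [z] ([eq_modulus_conj]), [v = - D / rho], and
    [x = B + rho (rho - C) / D - D / rho] is real. A conjugate pair has
    [(z + w)^2 <= 4 rho], which reads
    [(rho - m^2) (rho - n^2) (rho - (m + n)^2) <= 0]. The two components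
    [0 < rho <= m^2] and [n^2 <= rho <= (m + n)^2] lie on either side of
    [rho^3 = D^2], that is of [|v|^2 = rho]: the first one gives [Gamma_2], the
    second one [Gamma_1] ([Gamma1P], [Gamma2P]). The comparison of [x] with a
    critical value is governed by an exact factorisation
    ([pair_value_sub_critical]), so that the two sets are intervals whose
    finite endpoints are [eta = A_s(-m)], [beta = A_s(-n)] and
    [gamma = A_s(m + n)] ([Gamma1E], [Gamma2E]).

    For the dependence on [s], regard [A_s] as a function of [k]: it is
    [al k^2 + q k + b k^2 / (k - 1)], and [gamma] is its minimum over [k > 1],
    [beta] its maximum over [0 < k < 1], [eta] its minimum over [k < 0]
    ([gamma_min], [beta_max], [eta_min]). At fixed [k] it is affine in [b] with
    a slope of the sign of [k - 1], hence the three monotonicities. The limits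
    follow from explicit bounds, obtained by evaluating at well-chosen [k] or
    by completing a square. *)

(** * The symbol on the real line *)
Section RealSymbol.
Context {R : realType}.
Implicit Types a q b z k m n : R.

Definition coefB a q b : R := a + b *+ 2 + q.
Definition coefC a q b : R := b ^+ 2 + 2 * a * b + q * b.
Definition coefD a b : R := a * b ^+ 2.

Definition symbol a q b z : R :=
  z + coefB a q b + coefC a q b / z + coefD a b / z ^+ 2.

(** The critical points of the symbol are [-n], [-m] and [m + n]: the last two
    clauses are Vieta's relations for the roots of [z^3 = C z + 2 D], whose sum
    is zero. *)
Definition critical a q b m n : Prop :=
  [/\ 0 < m, m < b, b < n,
      m ^+ 2 + m * n + n ^+ 2 = coefC a q b
    & m * n * (m + n) = 2 * coefD a b].

(** The symbol in the coordinate [k = 1 + b / z], which makes it affine in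
    [b]. *)
Definition profile a q b k : R := a * k ^+ 2 + q * k + b * (k ^+ 2 / (k - 1)).

Definition attained_min (D : set R) (f : R -> R) (v : R) : Prop :=
  (exists2 k, D k & v = f k) /\ forall k, D k -> v <= f k.

Lemma profileE a q b k : 0 < b -> k != 1 ->
  profile a q b k = symbol a q b (b / (k - 1)).
Proof.
move=> b0 k1; have k10 : k - 1 != 0 by rewrite subr_eq0.
by rewrite /profile /symbol /coefB /coefC /coefD; field; rewrite k10 gt_eqF.
Qed.

Lemma cubic_ivt (e f g x y : R) : x <= y ->
  (x ^+ 3 + e * x ^+ 2 + f * x + g) * (y ^+ 3 + e * y ^+ 2 + f * y + g) <= 0 ->
  exists2 z, x <= z <= y & z ^+ 3 + e * z ^+ 2 + f * z + g = 0.
Proof.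
move=> xy hxy.
pose P : {poly R} := 'X^3 + e *: 'X^2 + f *: 'X + g%:P.
have PE z : P.[z] = z ^+ 3 + e * z ^+ 2 + f * z + g by rewrite /P !hornerE.
have [z zxy /rootP rz] : {z | z \in `[x, y] & root P z}.
  by apply: polyrcf.poly_ivt => //; rewrite !PE.
by exists z; [move: zxy; rewrite in_itv | rewrite -PE].
Qed.

(** The cubic [h z = z^3 - C z - 2 D] takes the value [q b^2 > 0] at [-b] and is
    negative at [0] and far to the left: this gives the two negative roots, on
    either side of [-b]. The relations for [C] and [D] follow by subtracting the
    equations of the two roots. *)
Lemma exists_critical a q b : 0 < a -> 0 < q -> 0 < b ->
  exists mn : R * R, critical a q b mn.1 mn.2.
Proof.
move=> a0 q0 b0; set C := coefC a q b; set D := coefD a b.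
have D0 : 0 < D by rewrite mulr_gt0 ?exprn_gt0.
have C0 : 0 < C by rewrite !addr_gt0 ?exprn_gt0 ?mulr_gt0.
pose h z := z ^+ 3 + 0 * z ^+ 2 + (- C) * z + (- (2 * D)).
have hb : h (- b) = q * b ^+ 2 by rewrite /h /C /D /coefC /coefD; ring.
have hb0 : 0 < h (- b) by rewrite hb mulr_gt0 ?exprn_gt0.
have h0 : h 0 = - (2 * D) by rewrite /h; ring.
have [x /andP[x1 x2] hx] : exists2 z, - (C + 1 + b) <= z <= - b & h z = 0.
  apply: cubic_ivt; first lra.
  rewrite -/(h _) -/(h (- b)) pmulr_lle0//.
  rewrite /h; set N := C + 1 + b.
  have -> : (- N) ^+ 3 + 0 * (- N) ^+ 2 + (- C) * - N + - (2 * D) =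
    - (N * (N ^+ 2 - C) + 2 * D) by ring.
  have NC : C <= N by rewrite /N; lra.
  have N1 : 1 <= N by rewrite /N; lra.
  have : 0 <= N * (N ^+ 2 - C) by rewrite mulr_ge0//; nra.
  by lra.
have [y /andP[y1 y2] hy] : exists2 z, - b <= z <= 0 & h z = 0.
  apply: cubic_ivt; first lra.
  by rewrite -/(h _) -/(h 0) h0 pmulr_rle0//; lra.
have neqb z : h z = 0 -> z != - b.
  by move=> hz; apply: contra_eq_neq hz => ->; rewrite gt_eqF.
have yn0 : y != 0 by apply: contra_eq_neq hy => ->; rewrite h0; lra.
have xb : x < - b by rewrite lt_neqAle neqb.
have yb : - b < y by rewrite lt_neqAle eq_sym neqb.
have y0 : y < 0 by rewrite lt_neqAle yn0.
have xyC : x ^+ 2 + x * y + y ^+ 2 = C.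
  have yx : y - x != 0 by rewrite subr_eq0; lra.
  have : (y - x) * (x ^+ 2 + x * y + y ^+ 2 - C) = h y - h x.
    by rewrite /h; ring.
  rewrite hx hy subrr => /eqP; rewrite mulf_eq0 (negbTE yx) subr_eq0.
  by move/eqP.
exists (- y, - x); split => /=; [lra|lra|lra| |].
  by rewrite -/C -xyC; ring.
have : h x = - y * (- x) * (- y + - x) - 2 * D by rewrite /h -xyC; ring.
by rewrite hx -/D; lra.
Qed.

(** At a critical point [z0] the cubic [z^2 (A(z) - A(z0))] has the double root
    [z0]; the product of its roots being [- D], the third one is
    [- D / z0^2]. *)
Lemma symbol_sub_critical a q b z z0 : z != 0 -> z0 != 0 ->
  z0 ^+ 3 = coefC a q b * z0 + 2 * coefD a b ->
  symbol a q b z - symbol a q b z0 =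
  (z - z0) ^+ 2 * (z + coefD a b / z0 ^+ 2) / z ^+ 2.
Proof.
move=> zn0 z0n0; set C := coefC a q b; set D := coefD a b => h.
rewrite /symbol -/C -/D.
have -> : C = z0 ^+ 2 - 2 * D / z0.
  by apply: (mulIf z0n0); rewrite mulrBl divfK// -exprSr h; ring.
by field; rewrite zn0 z0n0.
Qed.

Section Critical.
Variables (a q b m n : R).
Hypotheses (a0 : 0 < a) (q0 : 0 < q) (b0 : 0 < b) (mn : critical a q b m n).

Let m0 : 0 < m. Proof. by case: mn. Qed.
Let mb : m < b. Proof. by case: mn. Qed.
Let bn : b < n. Proof. by case: mn. Qed.
Let n0 : 0 < n. Proof. exact: lt_trans bn. Qed.
Let CE : m ^+ 2 + m * n + n ^+ 2 = coefC a q b.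
Proof. by case: mn. Qed.
Let DE : m * n * (m + n) = 2 * coefD a b. Proof. by case: mn. Qed.

Lemma critical_m : (- m) ^+ 3 =
  coefC a q b * (- m) + 2 * coefD a b.
Proof. by rewrite -CE -DE; ring. Qed.

Lemma critical_n : (- n) ^+ 3 =
  coefC a q b * (- n) + 2 * coefD a b.
Proof. by rewrite -CE -DE; ring. Qed.

Lemma critical_mn : (m + n) ^+ 3 =
  coefC a q b * (m + n) + 2 * coefD a b.
Proof. by rewrite -CE -DE; ring. Qed.

(** This and [lt_abn] locate the simple root [- D / z0^2] of the level cubic at
    [z0 = -m] and [z0 = -n] with respect to the zero [-b] of the symbol. The
    critical equation is rewritten so as to isolate the term in [q], the only
    one whose sign is known in advance. *)
Lemma lt_abm : m ^+ 2 < a * b.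
Proof.
have : 0 < (b - m) * (2 * (a * b) - m * (m + b)).
  have -> : (b - m) * (2 * (a * b) - m * (m + b)) = b * q * m.
    by have := critical_m; rewrite /coefC /coefD; lra.
  by rewrite !mulr_gt0.
have h : 0 < m * (b - m) by rewrite mulr_gt0 ?subr_gt0.
by rewrite pmulr_rgt0 ?subr_gt0//; lra.
Qed.

Lemma lt_abn : a * b < n ^+ 2.
Proof.
have : 0 < (n - b) * (n * (n + b) - 2 * (a * b)).
  have -> : (n - b) * (n * (n + b) - 2 * (a * b)) = b * q * n.
    by have := critical_n; rewrite /coefC /coefD; lra.
  by rewrite !mulr_gt0.
have h : 0 < n * (n - b) by rewrite mulr_gt0 ?subr_gt0.
by rewrite pmulr_rgt0 ?subr_gt0//; lra.
Qed.

(** The range [k > 1] is [z > 0], where the factor [z - v] of the level cubic,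
    with [v < 0] its simple root, is positive. *)
Lemma gamma_min :
  attained_min [set k | 1 < k] (profile a q b) (symbol a q b (m + n)).
Proof.
have mn_gt0 : 0 < m + n by rewrite addr_gt0.
split.
  have k1 : 1 < 1 + b / (m + n) by rewrite ltrDl divr_gt0.
  exists (1 + b / (m + n)) => //; rewrite profileE ?gt_eqF//; congr symbol.
  by rewrite addrAC subrr add0r invf_div mulrCA divff ?mulr1// gt_eqF.
move=> k k1; rewrite profileE ?gt_eqF//; set z := b / _.
have z0 : 0 < z by rewrite divr_gt0// subr_gt0.
rewrite -subr_ge0 (symbol_sub_critical _ _ critical_mn) ?gt_eqF//.
have D0 : 0 < coefD a b / (m + n) ^+ 2.
  by rewrite divr_gt0 ?exprn_gt0// mulr_gt0 ?exprn_gt0.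
by rewrite mulr_ge0 ?invr_ge0 ?sqr_ge0// mulr_ge0 ?sqr_ge0//; lra.
Qed.

(** The range [0 < k < 1] is [z < -b], which lies to the left of the simple root
    of the level cubic because [a b < n^2]. The maximum is written as a minimum
    of opposites. *)
Lemma beta_max :
  attained_min [set k | 0 < k < 1] (fun k => - profile a q b k)
    (- symbol a q b (- n)).
Proof.
have bn1 : b / n < 1 by rewrite ltr_pdivrMr// mul1r.
have bn0 : 0 < b / n by rewrite divr_gt0.
split.
  have k1 : 0 < 1 - b / n < 1 by rewrite gtrBl subr_gt0 bn1 bn0.
  exists (1 - b / n) => //; rewrite profileE ?lt_eqF//; last by case/andP: k1.
  congr (- symbol _ _ _ _).
  rewrite addrAC subrr add0r invrN invf_div mulrN mulrCA divff ?mulr1//.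
  by rewrite gt_eqF.
move=> k /= /andP[k0 k1]; rewrite profileE ?lt_eqF//; set z := b / _.
have zb : z < - b.
  by rewrite /z ltr_ndivrMr ?subr_lt0//; have := mulr_gt0 b0 k0; lra.
have z0 : z < 0 by apply: lt_trans zb _; rewrite oppr_lt0.
rewrite lerN2 -subr_le0 (symbol_sub_critical _ _ critical_n) ?lt_eqF
  ?oppr_lt0//.
rewrite mulr_le0_ge0 ?invr_ge0 ?sqr_ge0// mulr_ge0_le0 ?sqr_ge0//.
have : coefD a b / (- n) ^+ 2 < b; last by lra.
rewrite /coefD sqrrN ltr_pdivrMr ?exprn_gt0//.
by have := lt_abn; rewrite -(ltr_pM2l b0); lra.
Qed.

(** The range [k < 0] is [-b < z < 0], which lies to the right of the simple
    root of the level cubic because [m^2 < a b]. *)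
Lemma eta_min :
  attained_min [set k | k < 0] (profile a q b) (symbol a q b (- m)).
Proof.
have bm1 : 1 < b / m by rewrite ltr_pdivlMr// mul1r.
split.
  have k0 : 1 - b / m < 0 by rewrite subr_lt0.
  exists (1 - b / m) => //=; rewrite profileE ?lt_eqF//; [|lra].
  congr symbol.
  rewrite addrAC subrr add0r invrN invf_div mulrN mulrCA divff ?mulr1//.
  by rewrite gt_eqF.
move=> k /= k0; rewrite profileE ?lt_eqF//; [|lra]; set z := b / _.
have zb : - b < z.
  have bk : b * k < 0 by rewrite pmulr_rlt0.
  by rewrite /z ltr_ndivlMr ?subr_lt0; lra.
have z0 : z < 0 by rewrite /z nmulr_llt0// invr_lt0; lra.
rewrite -subr_ge0 (symbol_sub_critical _ _ critical_m) ?lt_eqF ?oppr_lt0//.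
rewrite mulr_ge0 ?invr_ge0 ?sqr_ge0// mulr_ge0 ?sqr_ge0//.
have : b < coefD a b / (- m) ^+ 2; last by lra.
rewrite /coefD sqrrN ltr_pdivlMr ?exprn_gt0//.
by have := lt_abm; rewrite -(ltr_pM2l b0); lra.
Qed.
End Critical.

(** Comparing extremal values only requires a pointwise comparison, because the
    larger one is attained. *)
Lemma attained_min_lt D (f g : R -> R) u v :
  attained_min D f u -> attained_min D g v ->
  (forall k, D k -> f k < g k) -> u < v.
Proof.
by move=> [_ fu] [[k Dk ->] _] fg; exact: le_lt_trans (fu _ Dk) (fg _ Dk).
Qed.

(** * Bounds on the three extremal values *)
Section Bounds.
Variables (a q b : R).
Hypotheses (a0 : 0 < a) (q0 : 0 < q) (b0 : 0 < b).

Section Gamma.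
Variable v : R.
Hypothesis hv : attained_min [set k | 1 < k] (profile a q b) v.

(** The value [a + q] separates [gamma] from [beta] (see [beta_lt]): it is
    [a k^2 + q k] at [k = 1], and the remaining term of the profile has the sign
    of [k - 1]. *)
Lemma gamma_gt : a + q < v.
Proof.
case: hv => -[k /= k1 ->] _; rewrite /profile.
have : 0 < b * (k ^+ 2 / (k - 1)).
  by rewrite mulr_gt0// divr_gt0 ?subr_gt0// exprn_gt0//; lra.
have : 0 < (k - 1) * (a * (k + 1) + q).
  by rewrite mulr_gt0 ?subr_gt0// addr_gt0// mulr_gt0//; lra.
by lra.
Qed.

Lemma gamma_gt_b : b < v.
Proof.
case: hv => -[k /= k1 ->] _; rewrite /profile.
have : b * 1 < b * (k ^+ 2 / (k - 1)).
  by rewrite ltr_pM2l// ltr_pdivlMr ?subr_gt0//; nra.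
have : 0 < a * k ^+ 2 by rewrite mulr_gt0 ?exprn_gt0//; lra.
have : 0 < q * k by rewrite mulr_gt0//; lra.
by lra.
Qed.

(** Evaluation at [k = 1 + sqrt b], which balances the two sources of error:
    both [k - 1] and [b / (k - 1)] tend to zero with [b]. *)
Lemma gamma_le :
  v <= (1 + Num.sqrt b) ^+ 2 * (a + Num.sqrt b) + q * (1 + Num.sqrt b).
Proof.
have e0 : 0 < Num.sqrt b by rewrite sqrtr_gt0.
case: hv => _ /(_ (1 + Num.sqrt b)) /= /(_ _)/le_trans; apply.
  by rewrite ltrDl.
rewrite /profile le_eqVlt; apply/orP; left; apply/eqP.
rewrite -{3}(sqr_sqrtr (ltW b0)).
by field; rewrite addrAC subrr add0r gt_eqF.
Qed.
End Gamma.

Section Beta.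
Variable v : R.
Hypothesis hv :
  attained_min [set k | 0 < k < 1] (fun k => - profile a q b k) (- v).

Lemma beta_attained : exists2 k, 0 < k < 1 & v = profile a q b k.
Proof. by case: hv => -[k k01 /oppr_inj vE] _; exists k. Qed.

Lemma beta_lt : v < a + q.
Proof.
have [k /andP[k0 k1] ->] := beta_attained; rewrite /profile.
have : b * (k ^+ 2 / (k - 1)) < 0.
  by rewrite pmulr_rlt0// pmulr_rlt0 ?exprn_gt0// invr_lt0; lra.
have : 0 < (1 - k) * (a * (k + 1) + q).
  by rewrite mulr_gt0 ?subr_gt0// addr_gt0// mulr_gt0//; lra.
by lra.
Qed.

(** At [k = q / (q + b)] the terms [q k] and [b k^2 / (k - 1)] cancel, which
    leaves [a k^2]. *)
Lemma beta_gt0 : 0 < v.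
Proof.
case: hv => _ /(_ (q / (q + b))) /=; rewrite lerN2.
have qb0 : 0 < q + b by rewrite addr_gt0.
have k0 : 0 < q / (q + b) by rewrite divr_gt0.
rewrite k0 ltr_pdivrMr// mul1r ltrDl b0 => /(_ isT); apply: lt_le_trans.
suff -> : profile a q b (q / (q + b)) = a * (q / (q + b)) ^+ 2.
  by rewrite mulr_gt0// exprn_gt0.
rewrite /profile; field; rewrite (gt_eqF qb0) /=.
by have -> : q + -1 * (q + b) = - b; [ring | rewrite oppr_eq0 gt_eqF].
Qed.

(** On [0 < k < 1] the profile is at most [(a + q) k - b k^2], a parabola whose
    maximum is the stated bound. *)
Lemma beta_le : v <= (a + q) ^+ 2 / (4 * b).
Proof.
have [k /andP[k0 k1] ->] := beta_attained; rewrite /profile.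
have : k ^+ 2 / (k - 1) <= - k ^+ 2 by rewrite ler_ndivrMr ?subr_lt0//; nra.
move=> /(ler_wpM2l (ltW b0)) h.
rewrite ler_pdivlMr ?mulr_gt0//.
have h2 : a * k ^+ 2 <= a * k by rewrite ler_pM2l//; nra.
apply: (@le_trans _ _ (((a + q) * k - b * k ^+ 2) * (4 * b))).
  by rewrite ler_pM2r ?mulr_gt0//; lra.
have := sqr_ge0 (a + q - 2 * b * k); lra.
Qed.

(** Evaluation at [k = 1 - sqrt b], as for [gamma_le]. *)
Lemma beta_ge : b < 1 ->
  (1 - Num.sqrt b) ^+ 2 * (a - Num.sqrt b) + q * (1 - Num.sqrt b) <= v.
Proof.
move=> b1; have e0 : 0 < Num.sqrt b by rewrite sqrtr_gt0.
have e1 : Num.sqrt b < 1 by rewrite -sqrtr1 ltr_sqrt.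
case: hv => _ /(_ (1 - Num.sqrt b)) /=; rewrite lerN2.
rewrite subr_gt0 e1 gtrBl e0 => /(_ isT); apply: le_trans.
rewrite /profile le_eqVlt; apply/orP; left; apply/eqP.
rewrite -{6}(sqr_sqrtr (ltW b0)).
by field; rewrite addrAC subrr add0r oppr_eq0 gt_eqF.
Qed.
End Beta.

Section Eta.
Variable v : R.
Hypothesis hv : attained_min [set k | k < 0] (profile a q b) v.

(** Evaluation at [k = - q / (2 a)], where [a k^2 + q k] is minimal. *)
Lemma eta_lt : v < - (q ^+ 2 / (4 * a)).
Proof.
have k0 : - (q / (2 * a)) < 0 by rewrite oppr_lt0 divr_gt0// mulr_gt0.
case: hv => _ /(_ _ k0)/le_lt_trans; apply; set k := - _ in k0 *.
have -> : - (q ^+ 2 / (4 * a)) = a * k ^+ 2 + q * k.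
  by rewrite /k; field; rewrite gt_eqF.
rewrite /profile gtrDl pmulr_rlt0// nmulr_llt0 ?invr_lt0; last lra.
by rewrite exprn_even_gt0//= lt_eqF.
Qed.

(** For [k < 0] one has [k <= k^2 / (k - 1)], so the profile is at least the
    parabola [a k^2 + (q + b) k], whose minimum is the stated bound. *)
Lemma eta_ge : - ((q + b) ^+ 2 / (4 * a)) <= v.
Proof.
case: hv => -[k /= k0 ->] _; rewrite /profile.
have : k <= k ^+ 2 / (k - 1) by rewrite ler_ndivlMr; nra.
move=> /(ler_wpM2l (ltW b0)) h.
apply: (@le_trans _ _ (a * k ^+ 2 + (q + b) * k)); last by lra.
rewrite lerNl ler_pdivlMr ?mulr_gt0//.
have := sqr_ge0 (q + b + 2 * a * k); lra.
Qed.

(** Evaluation at [k = -1]. *)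
Lemma eta_le : v <= a - q - b / 2.
Proof.
case: hv => _ /(_ (-1)) /=; rewrite ltrN10 => /(_ isT)/le_trans; apply.
rewrite /profile le_eqVlt; apply/orP; left; apply/eqP.
by field.
Qed.
End Eta.
End Bounds.
End RealSymbol.

(** * Pairs of solutions of equal modulus *)
Section Pair.
Context {R : realType}.
Implicit Types a q b B C D x y m n rho : R.

Lemma eq_normc (z w : R[i]) : `|z| = `|w| ->
  complex.Re z ^+ 2 + complex.Im z ^+ 2 = complex.Re w ^+ 2 + complex.Im w ^+ 2.
Proof.
rewrite !normc_def => /complexI/eqP.
by rewrite eqr_sqrt ?addr_ge0 ?sqr_ge0// => /eqP.
Qed.

Lemma le_normc (z w : R[i]) : (`|z| <= `|w|) =
  (complex.Re z ^+ 2 + complex.Im z ^+ 2 <=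
   complex.Re w ^+ 2 + complex.Im w ^+ 2).
Proof. by rewrite !normc_def lecR ler_sqrt// addr_ge0 ?sqr_ge0. Qed.

(** With [z = x1 + i y1] and [w = x2 + i y2], put [P = z w = P1 + i P2] and
    [S = z + w]. The hypotheses on [P1, P2] say [P^2 = C P + D S], which is what
    remains of Vieta's relations once the third root [- D / P] is eliminated.
    Since [P conj(S) = rho S], multiplying by [conj(P)] and taking real parts
    gives [(rho - P1) (2 P1 + rho - C) = 0]. If [P1 = rho], then
    [|z - conj(w)|^2 = 0]. Otherwise [C <= 3 rho], and computing [|D S|^2] gives
    [rho^2 (rho + C) <= 4 D^2]; together these yield [C^3 <= 27 D^2]. *)
Lemma conj_of_eq_modulus C D x1 y1 x2 y2 rho :
  0 < D -> 27 * D ^+ 2 < C ^+ 3 -> 0 < rho ->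
  x1 ^+ 2 + y1 ^+ 2 = rho -> x2 ^+ 2 + y2 ^+ 2 = rho ->
  let P1 := x1 * x2 - y1 * y2 in let P2 := x1 * y2 + x2 * y1 in
  P1 ^+ 2 - P2 ^+ 2 = C * P1 + D * (x1 + x2) ->
  2 * P1 * P2 = C * P2 + D * (y1 + y2) ->
  x2 = x1 /\ y2 = - y1.
Proof.
move=> D0 CD rho0 e1 e2 P1 P2 E1 E2.
have PP : P1 ^+ 2 + P2 ^+ 2 = rho ^+ 2.
  transitivity ((x1 ^+ 2 + y1 ^+ 2) * (x2 ^+ 2 + y2 ^+ 2)).
    by rewrite /P1 /P2; ring.
  by rewrite e1 e2 expr2.
have SP : (x1 + x2) * P1 + (y1 + y2) * P2 = rho * (x1 + x2).
  transitivity (x1 * (x2 ^+ 2 + y2 ^+ 2) + x2 * (x1 ^+ 2 + y1 ^+ 2)).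
    by rewrite /P1 /P2; ring.
  by rewrite e1 e2; ring.
have fac : rho * ((rho - P1) * (2 * P1 + rho - C)) = 0.
  have : P1 * (P1 ^+ 2 - P2 ^+ 2 - C * P1) + P2 * (2 * P1 * P2 - C * P2)
    - rho * (P1 ^+ 2 - P2 ^+ 2 - C * P1) = 0.
    rewrite E1 E2; transitivity
      (D * ((x1 + x2) * P1 + (y1 + y2) * P2 - rho * (x1 + x2))); first ring.
    by rewrite SP subrr mulr0.
  have -> : P2 ^+ 2 = rho ^+ 2 - P1 ^+ 2 by rewrite -PP; ring.
  have -> : P2 * (2 * P1 * P2 - C * P2) = (2 * P1 - C) * P2 ^+ 2 by ring.
  have -> : P2 ^+ 2 = rho ^+ 2 - P1 ^+ 2 by rewrite -PP; ring.
  by move=> <-; ring.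
move/eqP: fac; rewrite mulf_eq0 (gt_eqF rho0) /= mulf_eq0.
case/orP=> [/eqP h|/eqP h].
  have : (x1 - x2) ^+ 2 + (y1 + y2) ^+ 2 = 0.
    transitivity (x1 ^+ 2 + y1 ^+ 2 + (x2 ^+ 2 + y2 ^+ 2) - 2 * P1).
      by rewrite /P1; ring.
    by rewrite e1 e2; lra.
  move/eqP; rewrite paddr_eq0 ?sqr_ge0// !sqrf_eq0 subr_eq0 addr_eq0.
  by move=> /andP[/eqP -> /eqP ->]; rewrite opprK.
(* The remaining case contradicts 27 D^2 < C^3. *)
exfalso.
have P1le : P1 <= rho.
  have : 0 <= (x1 - x2) ^+ 2 + (y1 + y2) ^+ 2 by rewrite addr_ge0 ?sqr_ge0.
  have -> : (x1 - x2) ^+ 2 + (y1 + y2) ^+ 2 =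
      x1 ^+ 2 + y1 ^+ 2 + (x2 ^+ 2 + y2 ^+ 2) - 2 * P1.
    by rewrite /P1; ring.
  by rewrite e1 e2; lra.
have Sle : (x1 + x2) ^+ 2 + (y1 + y2) ^+ 2 <= 4 * rho.
  have : 0 <= (x1 - x2) ^+ 2 + (y1 - y2) ^+ 2 by rewrite addr_ge0 ?sqr_ge0.
  by move: e1 e2; lra.
have C0 : 0 < C.
  rewrite -(@exprn_odd_gt0 _ 3)//; apply: le_lt_trans CD.
  by rewrite mulr_ge0 ?sqr_ge0.
have Crho : C <= 3 * rho by lra.
have DS : D ^+ 2 * ((x1 + x2) ^+ 2 + (y1 + y2) ^+ 2) = rho ^+ 3 * (rho + C).
  transitivity ((C * P1 + D * (x1 + x2) - C * P1) ^+ 2 +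
    (C * P2 + D * (y1 + y2) - C * P2) ^+ 2); first ring.
  rewrite -E1 -E2.
  transitivity ((P1 ^+ 2 + P2 ^+ 2) *
    (P1 ^+ 2 + P2 ^+ 2 + C ^+ 2 - C * (2 * P1))); first ring.
  rewrite PP; have -> : 2 * P1 = C - rho by lra.
  by ring.
have D2 : D ^+ 2 * 4 >= rho ^+ 2 * (rho + C).
  move: Sle; rewrite -(ler_pM2l (exprn_gt0 2 D0)) DS => Sle.
  by rewrite -(ler_pM2l rho0); lra.
have : C ^+ 2 * (C * 4) <= (3 * rho) ^+ 2 * (3 * (rho + C)).
  apply: ler_pM; rewrite ?sqr_ge0//; [lra| |lra].
  by rewrite ler_pXn2r ?nnegrE//; lra.
lra.
Qed.

(** The last equation is the second Vieta relation with [z + w = 2 h] and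
    [v = - D / rho]. *)
Lemma eq_modulus_conj C D (z w v : R[i]) : 0 < D -> 27 * D ^+ 2 < C ^+ 3 ->
  z * w + v * (z + w) = C%:C -> z * w * v = - D%:C -> `|z| = `|w| ->
  exists h k, let rho := h ^+ 2 + k ^+ 2 in
    [/\ z = h +i* k, w = h -i* k, v = (- (D / rho))%:C, 0 < rho &
      rho * (rho - C) = 2 * h * D].
Proof.
move=> D0 CD e2 e3 nzw.
have zw0 : z * w != 0.
  apply: contra_eq_neq e3 => ->; rewrite mul0r eq_sym oppr_eq0.
  by rewrite (inj_eq (@complexI R) D 0) gt_eqF.
have E : (z * w) ^+ 2 = C%:C * (z * w) + D%:C * (z + w).
  rewrite -e2; have -> : D%:C = - (z * w * v) by rewrite e3 opprK.
  by ring.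
have vE : v = - D%:C / (z * w) by rewrite -e3 mulrC mulKf.
case: z w zw0 E vE nzw e2 {e3} => x1 y1 [x2 y2] zw0 E vE /eq_normc/= nzw e2.
have rho0 : 0 < x1 ^+ 2 + y1 ^+ 2.
  rewrite lt_neqAle addr_ge0 ?sqr_ge0// andbT eq_sym.
  apply: contra_neq zw0 => /eqP; rewrite paddr_eq0 ?sqr_ge0// !sqrf_eq0.
  by move=> /andP[/eqP -> /eqP ->]; rewrite mul0r.
have [] := @conj_of_eq_modulus C D x1 y1 x2 y2 _ D0 CD rho0 erefl (esym nzw).
- by move: E => /(congr1 (@complex.Re R)) /= E; lra.
- by move: E => /(congr1 (@complex.Im R)) /= E; lra.
move=> ? ?; subst x2 y2.
have zwE : (x1 +i* y1) * (x1 -i* y1) = (x1 ^+ 2 + y1 ^+ 2)%:C :> R[i].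
  by apply/eqP; rewrite eq_complex /=; apply/andP; split; apply/eqP; ring.
have vE' : v = (- (D / (x1 ^+ 2 + y1 ^+ 2)))%:C.
  by rewrite vE zwE rmorphN rmorphM fmorphV mulNr.
exists x1, y1; split => //.
move: e2; rewrite vE' zwE => /(congr1 (@complex.Re R)) /= e2.
set rho := _ + _ in rho0 e2 *.
have -> : C = rho - 2 * x1 * (D / rho) by rewrite -e2; ring.
by field; rewrite gt_eqF.
Qed.
End Pair.

(** * The sets Gamma_1 and Gamma_2 as intervals *)
Section Spectrum.
Context {R : realType}.

(** The difference is a polynomial of degree at most 2 that vanishes at the
    three points 1, -1 and 2. *)
Lemma monic_cubic_eq (e f g e' f' g' : R[i]) :
  (forall z, z != 0 -> z ^+ 3 + e * z ^+ 2 + f * z + g =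
     z ^+ 3 + e' * z ^+ 2 + f' * z + g') -> [/\ e = e', f = f' & g = g'].
Proof.
move=> H.
have E z : z != 0 -> (e - e') * z ^+ 2 + (f - f') * z + (g - g') = 0.
  move=> /H/eqP; rewrite -subr_eq0 => /eqP <-; ring.
have n2 : 2 != 0 :> R[i] by rewrite pnatr_eq0.
have n3 : 3 != 0 :> R[i] by rewrite pnatr_eq0.
have E1 := E 1 (oner_neq0 _).
have E2 := E 2 n2.
have E3 : (e - e') * (-1) ^+ 2 + (f - f') * (-1) + (g - g') = 0.
  by apply: E; rewrite oppr_eq0 oner_neq0.
have ff : f - f' = 0.
  apply: (mulfI n2); rewrite mulr0.
  by have := congr2 (fun u v => u - v) E1 E3; rewrite subrr => <-; ring.
rewrite ff !mul0r addr0 expr1n mulr1 in E1 E2.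
have ee : e - e' = 0.
  apply: (mulfI n3); rewrite mulr0.
  by have := congr2 (fun u v => u - v) E2 E1; rewrite subrr => <-; ring.
move: E1; rewrite ee add0r => gg.
by split; apply/eqP; rewrite -subr_eq0; apply/eqP.
Qed.

Lemma ordered_solutionsP (a t p s : R) x z1 z2 z3 :
  let al := a * (1 - t) ^+ 2 in let q := (1 - t) * p * t in
  let b := s * t * (1 - t) in
  ordered_solutions a t p s x z1 z2 z3 <->
  [/\ x = (coefB al q b)%:C + (z1 + z2 + z3),
      z1 * z2 + z3 * (z1 + z2) = (coefC al q b)%:C &
      z1 * z2 * z3 = - (coefD al b)%:C] /\
  [/\ `|z2| <= `|z1|, `|z3| <= `|z2| & 0 < `|z3|].
Proof.
move=> al q b.
have AE z : z != 0 -> A a t p s z - x =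
    (z ^+ 3 + ((coefB al q b)%:C - x) * z ^+ 2 +
     (coefC al q b)%:C * z + (coefD al b)%:C) / z ^+ 2.
  move=> z0; rewrite /A.
  have -> : s * t * (1 - t) = b by [].
  have -> : (1 - t) * (a * (1 - t) + (s + p) * t) = al + b + q.
    by rewrite /al /b /q; ring.
  have -> : a * s * t * (1 - t) ^+ 3 = al * b by rewrite /al /b; ring.
  have -> : coefB al q b = al + b + b + q by rewrite /coefB; ring.
  have -> : coefC al q b = b * b + al * b + al * b + q * b.
    by rewrite /coefC; ring.
  have -> : coefD al b = al * b * b by rewrite /coefD; ring.
  by rewrite !rmorphD !rmorphM /=; field.
have FE z : (z - z1) * (z - z2) * (z - z3) =
   z ^+ 3 + (- (z1 + z2 + z3)) * z ^+ 2 +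
   (z1 * z2 + z3 * (z1 + z2)) * z + - (z1 * z2 * z3) by ring.
split.
  case=> H h1 h2 h3; split=> //.
  have [] := @monic_cubic_eq
    ((coefB al q b)%:C - x) (coefC al q b)%:C (coefD al b)%:C
    (- (z1 + z2 + z3)) (z1 * z2 + z3 * (z1 + z2)) (- (z1 * z2 * z3)).
    move=> z z0; rewrite -FE; move: (H z z0); rewrite AE//.
    by apply: mulIf; rewrite invr_eq0 expf_neq0.
  move=> e1 e2 e3; split; rewrite ?e2 ?e3 ?opprK//.
  by rewrite -[z1 + _ + _]opprK -e1; ring.
case=> -[e1 e2 e3] [h1 h2 h3]; split => // z z0.
by rewrite AE// FE e2 e3 opprK e1 opprD addNKr.
Qed.

(** The value [x] whose level cubic has a conjugate pair of roots of squared
    modulus [rho]: it is [B] plus the sum of the roots, where the pair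
    contributes [rho (rho - C) / D] and the third root [- D / rho]. *)
Definition pair_value (B C D rho : R) := B + rho * (rho - C) / D - D / rho.

Section Gammas.
Variables (a t p s m n : R).
Let al := a * (1 - t) ^+ 2.
Let q := (1 - t) * p * t.
Let b := s * t * (1 - t).
Hypotheses (al0 : 0 < al) (b0 : 0 < b) (mn : critical al q b m n).
Let B := coefB al q b.
Let C := coefC al q b.
Let D := coefD al b.
Let m0 : 0 < m. Proof. by case: mn. Qed.
Let mltn : m < n. Proof. by case: mn => _ + + _ _; exact: lt_trans. Qed.
Let n0 : 0 < n. Proof. exact: lt_trans mltn. Qed.
Let D0 : 0 < D. Proof. by rewrite mulr_gt0 ?exprn_gt0. Qed.
Let CE : C = m ^+ 2 + m * n + n ^+ 2. Proof. by case: mn. Qed.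
Let DE : D = m * n * (m + n) / 2.
Proof. by case: mn => _ _ _ _ ->; rewrite /D /coefD; field. Qed.

(** [4 C^3 - 108 D^2] is the discriminant of [z^3 - C z - 2 D], whose roots
    [-n], [-m], [m + n] are distinct. *)
Let CD : 27 * D ^+ 2 < C ^+ 3.
Proof.
rewrite -subr_gt0; have -> : C ^+ 3 - 27 * D ^+ 2 =
  ((n - m) * (2 * m + n) * (m + 2 * n)) ^+ 2 / 4 by rewrite CE DE; field.
have h : 0 < n - m by rewrite subr_gt0.
by rewrite divr_gt0// exprn_gt0// !mulr_gt0// addr_gt0// mulr_gt0.
Qed.

(** If [2 h] is the sum of a conjugate pair of squared modulus [rho], then
    [h^2 <= rho]; this identity turns the condition into a position of [rho]
    with respect to the squares of the critical points, where the two roots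
    merge. *)
Let pair_factor h rho : rho * (rho - C) = 2 * h * D ->
  4 * D ^+ 2 * (h ^+ 2 - rho) =
  rho * ((rho - m ^+ 2) * ((rho - n ^+ 2) * (rho - (m + n) ^+ 2))).
Proof.
move=> e; transitivity ((2 * h * D) ^+ 2 - 4 * D ^+ 2 * rho); first ring.
by rewrite -e CE DE; field.
Qed.

Let m2_lt_n2 : m ^+ 2 < n ^+ 2.
Proof. by rewrite ltr_pXn2r ?nnegrE// ltW. Qed.

Let n2_lt_mn2 : n ^+ 2 < (m + n) ^+ 2.
Proof. by rewrite ltr_pXn2r ?nnegrE ?ltrDr// ltW// addr_gt0. Qed.

Let pair_bound h rho :
  0 < rho -> h ^+ 2 <= rho -> rho * (rho - C) = 2 * h * D ->
  rho <= m ^+ 2 \/ n ^+ 2 <= rho <= (m + n) ^+ 2.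
Proof.
move=> rho0 hrho e.
have : (rho - m ^+ 2) * ((rho - n ^+ 2) * (rho - (m + n) ^+ 2)) <= 0.
  rewrite -(pmulr_rle0 _ rho0) -(pair_factor e).
  by rewrite mulr_ge0_le0 ?subr_le0// mulr_ge0 ?sqr_ge0.
have [?|mr] := leP rho (m ^+ 2); first by left.
rewrite pmulr_rle0 ?subr_gt0// => h2; right.
have [?|nr] := ltP rho (n ^+ 2).
  by move: h2 n2_lt_mn2; rewrite nmulr_rle0 ?subr_lt0// subr_ge0; lra.
have [//|] := leP rho ((m + n) ^+ 2).
move=> h3; move: h2; rewrite leNgt mulr_gt0 ?subr_gt0//.
by have := n2_lt_mn2; lra.
Qed.

(** The third root [- D / rho] has squared modulus [D^2 / rho^2]. By this and
    the next inequality it is the largest root when [rho <= m^2] and the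
    smallest one when [n^2 <= rho]. *)
Let m6_lt : (m ^+ 2) ^+ 3 < D ^+ 2.
Proof.
have -> : (m ^+ 2) ^+ 3 = (m ^+ 3) ^+ 2 by ring.
rewrite ltr_pXn2r ?nnegrE//; [|by rewrite exprn_ge0// ltW|by rewrite ltW].
have h : 0 < m * ((n - m) * (n + 2 * m)).
  by rewrite !mulr_gt0 ?subr_gt0// addr_gt0// mulr_gt0.
by rewrite DE; lra.
Qed.

Let n6_gt : D ^+ 2 < (n ^+ 2) ^+ 3.
Proof.
have -> : (n ^+ 2) ^+ 3 = (n ^+ 3) ^+ 2 by ring.
rewrite ltr_pXn2r ?nnegrE//; [|by rewrite ltW|by rewrite exprn_ge0// ltW].
have h : 0 < n * ((n - m) * (2 * n + m)).
  by rewrite !mulr_gt0 ?subr_gt0// addr_gt0// mulr_gt0.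
by rewrite DE; lra.
Qed.

Let pair_valueE h rho : 0 < rho -> rho * (rho - C) = 2 * h * D ->
  pair_value B C D rho = B + (h + h - D / rho).
Proof. by move=> rho0 e; rewrite /pair_value e; field; rewrite !gt_eqF. Qed.

Let tail_le h k rho : h ^+ 2 + k ^+ 2 = rho -> 0 < rho ->
  (`|(- (D / rho))%:C : R[i]| <= `|h +i* k|) = (D ^+ 2 <= rho ^+ 3).
Proof.
move=> e rho0; rewrite le_normc /= e expr0n addr0 sqrrN expr_div_n.
by rewrite ler_pdivrMr ?exprn_gt0// -exprS.
Qed.

Let tail_ge h k rho : h ^+ 2 + k ^+ 2 = rho -> 0 < rho ->
  (`|h +i* k| <= `|(- (D / rho))%:C : R[i]|) = (rho ^+ 3 <= D ^+ 2).
Proof.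
move=> e rho0; rewrite le_normc /= e expr0n addr0 sqrrN expr_div_n.
by rewrite ler_pdivlMr ?exprn_gt0// -exprS.
Qed.

Let conj_norm h k : `|h +i* k : R[i]| = `|h -i* k|.
Proof. by rewrite !normc_def /= sqrrN. Qed.

Let sq_le h k : h ^+ 2 <= h ^+ 2 + k ^+ 2 :> R.
Proof. by rewrite lerDl sqr_ge0. Qed.

Let conj_sum h k w : (h +i* k) + (h -i* k) + w%:C = (h + h + w)%:C :> R[i].
Proof. by apply/eqP; rewrite eq_complex /= !addr0 subrr !eqxx. Qed.

Let conj_mul h k : (h +i* k) * (h -i* k) = (h ^+ 2 + k ^+ 2)%:C :> R[i].
Proof.
by apply/eqP; rewrite eq_complex /=; apply/andP; split; apply/eqP; ring.
Qed.

Let conj_add h k : (h +i* k) + (h -i* k) = (h + h)%:C :> R[i].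
Proof. by apply/eqP; rewrite eq_complex /= subrr !eqxx. Qed.

(** Converse of [pair_bound]: the second Vieta relation prescribes the real part
    [h], and the factorisation makes [rho - h^2] nonnegative, so that an
    imaginary part exists. *)
Let conj_pair_of_modulus rho :
  0 < rho -> rho <= m ^+ 2 \/ n ^+ 2 <= rho <= (m + n) ^+ 2 ->
  exists h k, [/\ h ^+ 2 + k ^+ 2 = rho,
    (pair_value B C D rho)%:C =
      B%:C + ((h +i* k) + (h -i* k) + (- (D / rho))%:C),
    (h +i* k) * (h -i* k) + (- (D / rho))%:C * ((h +i* k) + (h -i* k)) = C%:C &
    (h +i* k) * (h -i* k) * (- (D / rho))%:C = - D%:C].
Proof.
move=> rho0 hrho; pose h := rho * (rho - C) / (2 * D).
have hE : rho * (rho - C) = 2 * h * D by rewrite /h; field; rewrite gt_eqF.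
have hle : h ^+ 2 <= rho.
  have D4 : 0 < 4 * D ^+ 2 by rewrite mulr_gt0 ?exprn_gt0.
  rewrite -subr_le0 -(pmulr_rle0 _ D4) (pair_factor hE) pmulr_rle0//.
  case: hrho => [h1|/andP[h1 h2]].
    rewrite mulr_le0_ge0 ?subr_le0// mulr_le0 ?subr_le0//; have := m2_lt_n2;
      have := n2_lt_mn2; lra.
  rewrite mulr_ge0_le0 ?subr_ge0//; first by have := m2_lt_n2; lra.
  by rewrite mulr_ge0_le0 ?subr_ge0 ?subr_le0.
have kE : h ^+ 2 + Num.sqrt (rho - h ^+ 2) ^+ 2 = rho.
  by rewrite sqr_sqrtr ?subr_ge0// addrC subrK.
exists h, (Num.sqrt (rho - h ^+ 2)); split => //.
- by rewrite conj_sum -rmorphD (pair_valueE rho0 hE).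
- rewrite conj_mul kE conj_add -rmorphM -rmorphD; congr (_%:C).
  have -> : C = rho - 2 * h * D / rho by rewrite -hE; field; rewrite gt_eqF.
  by field; rewrite gt_eqF.
- by rewrite conj_mul kE -rmorphM -rmorphN; congr (_%:C); field; rewrite gt_eqF.
Qed.

Lemma Gamma1P x : Gamma1 a t p s x <->
  exists2 rho, n ^+ 2 <= rho <= (m + n) ^+ 2 & x = (pair_value B C D rho)%:C.
Proof.
split.
  move=> [z1 [z2 [z3 [/ordered_solutionsP [[xE e2 e3] [h1 h2 h3]] z12]]]].
  have [h [k /= [zE wE vE rho0 hrho]]] := eq_modulus_conj D0 CD e2 e3 z12.
  exists (h ^+ 2 + k ^+ 2); last first.
    by rewrite xE (pair_valueE rho0 hrho) zE wE vE conj_sum -rmorphD.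
  have [rm|//] := pair_bound rho0 (sq_le h k) hrho.
  move: h2; rewrite vE wE -(conj_norm h k) (tail_le erefl rho0) leNgt.
  move=> /negP[].
  by apply: (le_lt_trans _ m6_lt); rewrite lerXn2r ?nnegrE ?sqr_ge0// ltW.
move=> [rho rhoE ->].
have rho0 : 0 < rho.
  by case/andP: rhoE => + _; apply: lt_le_trans; rewrite exprn_gt0.
have [h [k [kE e1 e2 e3]]] := conj_pair_of_modulus rho0 (or_intror rhoE).
exists (h +i* k), (h -i* k), (- (D / rho))%:C; split; last exact: conj_norm.
apply/ordered_solutionsP; split => //; split.
- by rewrite (conj_norm h k).
- rewrite -(conj_norm h k) (tail_le kE rho0) (le_trans (ltW n6_gt))//.
  by case/andP: rhoE => ? _; rewrite lerXn2r ?nnegrE ?sqr_ge0// ltW.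
- rewrite normr_gt0 (inj_eq (@complexI R) _ 0) oppr_eq0 gt_eqF// divr_gt0//.
Qed.

Lemma Gamma2P x : Gamma2 a t p s x <->
  exists2 rho, 0 < rho <= m ^+ 2 & x = (pair_value B C D rho)%:C.
Proof.
split.
  move=> [z1 [z2 [z3 [/ordered_solutionsP [[xE e2 e3] [h1 h2 h3]] z12]]]].
  have e2' : z2 * z3 + z1 * (z2 + z3) = C%:C by rewrite -[RHS]e2; ring.
  have e3' : z2 * z3 * z1 = - D%:C by rewrite -[RHS]e3; ring.
  have [h [k /= [zE wE vE rho0 hrho]]] := eq_modulus_conj D0 CD e2' e3' z12.
  exists (h ^+ 2 + k ^+ 2); last first.
    rewrite xE; have -> : z1 + z2 + z3 = z2 + z3 + z1 by ring.
    by rewrite (pair_valueE rho0 hrho) zE wE vE conj_sum -rmorphD.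
  have [rm|/andP[rn _]] := pair_bound rho0 (sq_le h k) hrho.
    by rewrite rho0.
  move: h1; rewrite vE zE (tail_ge erefl rho0) leNgt => /negP[].
  by apply: (lt_le_trans n6_gt); rewrite lerXn2r ?nnegrE ?sqr_ge0// ltW.
move=> [rho /andP[rho0 rhoE] ->].
have [h [k [kE e1 e2 e3]]] := conj_pair_of_modulus rho0 (or_introl rhoE).
exists (- (D / rho))%:C, (h +i* k), (h -i* k); split; last exact: conj_norm.
apply/ordered_solutionsP; split; split.
- by rewrite e1; congr (_ + _); ring.
- by rewrite -[RHS]e2; ring.
- by rewrite -[RHS]e3; ring.
- rewrite (tail_ge kE rho0) (le_trans _ (ltW m6_lt))//.
  by rewrite lerXn2r ?nnegrE ?sqr_ge0// ltW.
- by rewrite (conj_norm h k).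
- rewrite normr_gt0; apply: contra_eq_neq e3 => ->.
  by rewrite mulr0 mul0r eq_sym oppr_eq0 (inj_eq (@complexI R) D 0) gt_eqF.
Qed.

(** The analogue of [symbol_sub_critical] in the variable [rho]. The numerator
    on the left is a cubic in [rho] with the double root [- D / z0], so that the
    sign of the difference is that of [rho - z0^2]. *)
Lemma pair_value_sub_critical rho z0 : rho != 0 -> z0 != 0 ->
  z0 ^+ 3 = C * z0 + 2 * D ->
  pair_value B C D rho - symbol al q b z0 =
  (rho - z0 ^+ 2) * (rho + D / z0) ^+ 2 / (D * rho).
Proof.
move=> rho0 z00 z0E.
have -> : symbol al q b z0 = z0 + B + C / z0 + D / z0 ^+ 2 by [].
have -> : C = z0 ^+ 2 - 2 * D / z0.
  by apply: (mulIf z00); rewrite mulrBl divfK// -exprSr z0E; ring.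
by rewrite /pair_value; field; rewrite rho0 z00 gt_eqF.
Qed.

(** The lower endpoint [r1 = 0] stands for [pair_value = -oo]: after clearing
    denominators, the cubic [h] is negative there. *)
Let pair_value_ivt r1 r2 x : 0 <= r1 <= r2 ->
  r1 = 0 \/ pair_value B C D r1 <= x -> 0 < r2 -> x <= pair_value B C D r2 ->
  exists2 rho, r1 <= rho <= r2 & 0 < rho /\ pair_value B C D rho = x.
Proof.
move=> /andP[r10 r12] hr1 r20 hr2.
pose h r := r ^+ 3 + (- C) * r ^+ 2 + (- ((x - B) * D)) * r + (- D ^+ 2).
have hE r : 0 < r -> h r = D * r * (pair_value B C D r - x).
  by move=> r0; rewrite /h /pair_value; field; rewrite !gt_eqF.
have h0 : h 0 < 0.
  have -> : h 0 = - D ^+ 2 by rewrite /h; ring.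
  by rewrite oppr_lt0 exprn_gt0.
have h1 : h r1 <= 0.
  case: hr1 => [->|hr1]; first exact: ltW.
  case: (eqVneq r1 0) => [->|r1n]; first exact: ltW.
  have r1p : 0 < r1 by rewrite lt_neqAle eq_sym r1n.
  by rewrite hE// mulr_ge0_le0 ?subr_le0// ltW// mulr_gt0.
have h2 : 0 <= h r2 by rewrite hE// mulr_ge0 ?subr_ge0// ltW// mulr_gt0.
have [rho rhoE hrho] := @cubic_ivt R _ _ _ _ _ r12 (mulr_le0_ge0 h1 h2).
have rho0 : 0 < rho.
  rewrite lt_neqAle (le_trans r10) ?andbT; last by case/andP: rhoE.
  by apply: contra_eq_neq hrho => <-; rewrite -/(h 0) lt_eqF.
exists rho => //; split=> //; move/eqP: hrho; rewrite -/(h rho) hE//.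
by rewrite mulf_eq0 (gt_eqF (mulr_gt0 D0 rho0)) subr_eq0 => /eqP.
Qed.

Lemma pair_value_ge rho z0 : 0 < rho -> z0 != 0 ->
  z0 ^+ 3 = C * z0 + 2 * D -> z0 ^+ 2 <= rho ->
  symbol al q b z0 <= pair_value B C D rho.
Proof.
move=> rho0 z00 z0E h.
rewrite -subr_ge0 (pair_value_sub_critical (lt0r_neq0 rho0))//.
apply: divr_ge0; last by rewrite ltW// mulr_gt0.
by rewrite mulr_ge0 ?sqr_ge0 ?subr_ge0.
Qed.

Lemma pair_value_le rho z0 : 0 < rho -> z0 != 0 ->
  z0 ^+ 3 = C * z0 + 2 * D -> rho <= z0 ^+ 2 ->
  pair_value B C D rho <= symbol al q b z0.
Proof.
move=> rho0 z00 z0E h.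
rewrite -subr_le0 (pair_value_sub_critical (lt0r_neq0 rho0))//.
apply: mulr_le0_ge0; last by rewrite invr_ge0 ltW// mulr_gt0.
by rewrite mulr_le0_ge0 ?sqr_ge0 ?subr_le0.
Qed.

Lemma Gamma1E : Gamma1 a t p s =
  inC `[symbol al q b (- n), symbol al q b (m + n)].
Proof.
have mn0 : 0 < m + n by rewrite addr_gt0.
have cn := critical_n mn; have cmn := critical_mn mn.
have nn0 : - n != 0 by rewrite oppr_eq0 gt_eqF.
have mnn0 : m + n != 0 by rewrite gt_eqF.
have n20 : 0 < n ^+ 2 by rewrite exprn_gt0.
have mn20 : 0 < (m + n) ^+ 2 by rewrite exprn_gt0.
apply/seteqP; split => x.
  move=> /Gamma1P[rho /andP[h1 h2] ->].
  have rho0 : 0 < rho by exact: lt_le_trans h1.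
  exists (pair_value B C D rho) => //=; rewrite in_itv /=.
  by rewrite pair_value_ge ?sqrrN// pair_value_le.
move=> [y /=]; rewrite in_itv /= => /andP[y1 y2] <-.
have [] := @pair_value_ivt (n ^+ 2) ((m + n) ^+ 2) y.
- by rewrite (ltW n20) /= lerXn2r ?nnegrE ?lerDr// ltW.
- by right; apply: le_trans y1; rewrite pair_value_le ?sqrrN.
- by [].
- by apply: le_trans y2 _; rewrite pair_value_ge.
by move=> rho h [_ <-]; apply/Gamma1P; exists rho.
Qed.

Lemma Gamma2E : Gamma2 a t p s = inC `]-oo, symbol al q b (- m)].
Proof.
have cm := critical_m mn.
have mm0 : - m != 0 by rewrite oppr_eq0 gt_eqF.
have m20 : 0 < m ^+ 2 by rewrite exprn_gt0.
apply/seteqP; split => x.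
  move=> /Gamma2P[rho /andP[rho0 h2] ->].
  exists (pair_value B C D rho) => //=; rewrite in_itv /=.
  by rewrite pair_value_le ?sqrrN.
move=> [y /=]; rewrite in_itv /= => y2 <-.
have [] := @pair_value_ivt 0 (m ^+ 2) y.
- by rewrite lexx ltW.
- by left.
- by [].
- by apply: le_trans y2 _; rewrite pair_value_ge ?sqrrN.
by move=> rho /andP[_ h] [r0 <-]; apply/Gamma2P; exists rho; rewrite ?r0.
Qed.
End Gammas.
End Spectrum.

(** * Dependence on the parameter *)
Section Limits.
Context {R : realType}.
Variables (a q c : R) (v : R -> R).
Hypotheses (a0 : 0 < a) (q0 : 0 < q) (c0 : 0 < c).

Let sc_gt0 s : 0 < s -> 0 < s * c. Proof. by move=> s0; rewrite mulr_gt0. Qed.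

Lemma cvg_scale : s * c @[s --> 0^'+] --> (0 : R).
Proof.
apply: cvg_at_right_filter; rewrite -[X in _ --> X](mul0r c).
by apply: cvgM; [exact: cvg_id | exact: cvg_cst].
Qed.

Lemma cvg_sqrt_scale : Num.sqrt (s * c) @[s --> 0^'+] --> (0 : R).
Proof.
rewrite -[X in _ --> X](sqrtr0 R).
exact: (continuous_cvg _ (@sqrt_continuous R 0) cvg_scale).
Qed.

Lemma cvg_scaley : c * s @[s --> +oo] --> +oo.
Proof. by apply: gt0_cvgMry; [exact: c0 | exact: cvg_id]. Qed.

Section Gamma.
Hypothesis hv : forall s, 0 < s ->
  attained_min [set k | 1 < k] (profile a q (s * c)) (v s).

Lemma gamma_cvg0 : v s @[s --> 0^'+] --> a + q.
Proof.
apply: (@squeeze_cvgr _ _ _ _ (fun=> a + q)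
  (fun s => (1 + Num.sqrt (s * c)) ^+ 2 *
  (a + Num.sqrt (s * c)) + q * (1 + Num.sqrt (s * c)))).
- near=> s; have s0 : 0 < s by [].
  rewrite (gamma_le (sc_gt0 s0) (hv s0)) ltW//.
  exact: (gamma_gt a0 q0 (sc_gt0 s0) (hv s0)).
- exact: cvg_cst.
- have -> : a + q = (1 + 0) * (1 + 0) * (a + 0) + q * (1 + 0) by ring.
  have h1 : 1 + Num.sqrt (s * c) @[s --> 0^'+] --> (1 + 0 : R).
    exact: cvgD (cvg_cst _) cvg_sqrt_scale.
  have h2 : a + Num.sqrt (s * c) @[s --> 0^'+] --> a + 0.
    exact: cvgD (cvg_cst _) cvg_sqrt_scale.
  exact: cvgD (cvgM (cvgM h1 h1) h2) (cvgM (cvg_cst q) h1).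
Unshelve. all: end_near. Qed.

Lemma gamma_cvgy : v s @[s --> +oo] --> +oo.
Proof.
apply: ger_cvgy cvg_scaley; near=> s.
have s0 : 0 < s by near: s; exact: nbhs_pinfty_gt.
by rewrite mulrC ltW// (gamma_gt_b a0 q0 (sc_gt0 s0) (hv s0)).
Unshelve. all: end_near. Qed.

Lemma gamma_incr s1 s2 : 0 < s1 -> s1 < s2 -> v s1 < v s2.
Proof.
move=> s10 s12; have s20 := lt_trans s10 s12.
apply: attained_min_lt (hv s10) (hv s20) _ => k /= k1.
rewrite /profile ltrD2l ltr_pM2r ?ltr_pM2r// divr_gt0 ?exprn_gt0 ?subr_gt0//.
by apply: lt_trans k1.
Qed.
End Gamma.

Section Beta.
Hypothesis hv : forall s, 0 < s ->
  attained_min [set k | 0 < k < 1] (fun k => - profile a q (s * c) k) (- v s).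

Lemma beta_cvg0 : v s @[s --> 0^'+] --> a + q.
Proof.
apply: (@squeeze_cvgr _ _ _ _ (fun s => (1 - Num.sqrt (s * c)) ^+ 2 *
  (a - Num.sqrt (s * c)) + q * (1 - Num.sqrt (s * c))) (fun=> a + q)).
- near=> s; have s0 : 0 < s by [].
  rewrite (beta_ge (sc_gt0 s0) (hv s0)) ?ltW//.
    exact: (beta_lt a0 q0 (sc_gt0 s0) (hv s0)).
  by near: s; apply: cvgr_lt cvg_scale _ _.
- have -> : a + q = (1 - 0) * (1 - 0) * (a - 0) + q * (1 - 0) by ring.
  have h1 : 1 - Num.sqrt (s * c) @[s --> 0^'+] --> (1 - 0 : R).
    exact: cvgB (cvg_cst _) cvg_sqrt_scale.
  have h2 : a - Num.sqrt (s * c) @[s --> 0^'+] --> a - 0.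
    exact: cvgB (cvg_cst _) cvg_sqrt_scale.
  exact: cvgD (cvgM (cvgM h1 h1) h2) (cvgM (cvg_cst q) h1).
- exact: cvg_cst.
Unshelve. all: end_near. Qed.

Lemma beta_cvgy : v s @[s --> +oo] --> (0 : R).
Proof.
apply: (@squeeze_cvgr _ _ _ _ (fun=> 0)
  (fun s => (a + q) ^+ 2 / 4 * (c * s)^-1)).
- near=> s; have s0 : 0 < s by near: s; exact: nbhs_pinfty_gt.
  rewrite ltW ?(beta_gt0 a0 q0 (sc_gt0 s0) (hv s0))//=.
  rewrite (le_trans (beta_le a0 (sc_gt0 s0) (hv s0)))//.
  by rewrite (mulrC c) invfM mulrA.
- exact: cvg_cst.
- rewrite -[X in _ --> X](mulr0 ((a + q) ^+ 2 / 4)).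
  apply: cvgM; first exact: cvg_cst.
  apply/gtr0_cvgV0; last exact: cvg_scaley.
  by near=> s; rewrite mulr_gt0//; near: s; exact: nbhs_pinfty_gt.
Unshelve. all: end_near. Qed.

Lemma beta_decr s1 s2 : 0 < s1 -> s1 < s2 -> v s2 < v s1.
Proof.
move=> s10 s12; have s20 := lt_trans s10 s12.
rewrite -ltrN2; apply: attained_min_lt (hv s10) (hv s20) _ => k /= /andP[k0 k1].
rewrite /profile ltrN2 ltrD2l ltr_nM2r ?ltr_pM2r//.
by rewrite pmulr_rlt0 ?exprn_gt0// invr_lt0 subr_lt0.
Qed.
End Beta.

Section Eta.
Hypothesis hv : forall s, 0 < s ->
  attained_min [set k | k < 0] (profile a q (s * c)) (v s).

Lemma eta_cvg0 : v s @[s --> 0^'+] --> - (q ^+ 2 / (4 * a)).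
Proof.
apply: (@squeeze_cvgr _ _ _ _ (fun s => - ((q + s * c) ^+ 2 / (4 * a)))
  (fun=> - (q ^+ 2 / (4 * a)))).
- near=> s; have s0 : 0 < s by [].
  rewrite (eta_ge a0 (sc_gt0 s0) (hv s0)) ltW//.
  exact: (eta_lt a0 q0 (sc_gt0 s0) (hv s0)).
- have -> : q ^+ 2 = (q + 0) * (q + 0) by ring.
  have h1 : q + s * c @[s --> 0^'+] --> q + 0.
    exact: cvgD (cvg_cst _) cvg_scale.
  exact: cvgN (cvgM (cvgM h1 h1) (cvg_cst _)).
- exact: cvg_cst.
Unshelve. all: end_near. Qed.

Lemma eta_cvgy : v s @[s --> +oo] --> -oo.
Proof.
apply: (@ler_cvgNy _ _ _ _ (fun s => a - q - s * c / 2)).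
  near=> s; have s0 : 0 < s by near: s; exact: nbhs_pinfty_gt.
  exact: eta_le (hv s0).
apply/cvgrNyPle => M; near=> s.
have : (a - q - M) * 2 / c <= s by near: s; exact: nbhs_pinfty_ge (num_real _).
by rewrite ler_pdivrMr//; lra.
Unshelve. all: end_near. Qed.

Lemma eta_decr s1 s2 : 0 < s1 -> s1 < s2 -> v s2 < v s1.
Proof.
move=> s10 s12; have s20 := lt_trans s10 s12.
apply: attained_min_lt (hv s20) (hv s10) _ => k /= k0.
rewrite /profile ltrD2l ltr_nM2r ?ltr_pM2r//.
have k2 : 0 < k ^+ 2 by rewrite exprn_even_gt0//= lt_eqF.
by rewrite pmulr_rlt0// invr_lt0; lra.
Qed.
End Eta.
End Limits.

Theorem proposition1p5 (R : realType) (a t p : R)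
    (a_gt0 : 0 < a) (t_gt0 : 0 < t) (t_lt1 : t < 1) (p_gt0 : 0 < p) :
  (forall s : R, 0 < s ->
     Gamma1 a t p s `<=` inC `]0, +oo[ /\
     Gamma2 a t p s `<=` inC `]-oo, - (p ^+ 2 * t ^+ 2 / (4 * a))]) /\
  exists eta beta gamma : R -> R,
    [/\ forall s : R, 0 < s ->
          [/\ eta s < 0, 0 < beta s, beta s < gamma s,
              Gamma1 a t p s = inC `[beta s, gamma s]
            & Gamma2 a t p s = inC `]-oo, eta s]],
        [/\ forall s1 s2 : R, 0 < s1 -> s1 < s2 -> gamma s1 < gamma s2,
            gamma s @[s --> 0^'+] --> (1 - t) * (a * (1 - t) + p * t)
          & gamma s @[s --> +oo] --> +oo],
        [/\ forall s : R, 0 < s -> 0 < beta s,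
            forall s1 s2 : R, 0 < s1 -> s1 < s2 -> beta s2 < beta s1,
            beta s @[s --> 0^'+] --> (1 - t) * (a * (1 - t) + p * t)
          & beta s @[s --> +oo] --> (0 : R)]
      & [/\ forall s : R, 0 < s -> eta s < 0,
            forall s1 s2 : R, 0 < s1 -> s1 < s2 -> eta s2 < eta s1,
            eta s @[s --> 0^'+] --> - (p ^+ 2 * t ^+ 2 / (4 * a))
          & eta s @[s --> +oo] --> -oo]].
Proof.
have u0 : 0 < 1 - t by rewrite subr_gt0.
set al := a * (1 - t) ^+ 2; set q := (1 - t) * p * t; set c := t * (1 - t).
have al0 : 0 < al by rewrite mulr_gt0 ?exprn_gt0.
have q0 : 0 < q by rewrite !mulr_gt0.
have c0 : 0 < c by rewrite mulr_gt0.
have [mn mnP] : {f : R -> R * R & forall s, 0 < s ->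
    critical al q (s * c) (f s).1 (f s).2}.
  apply: (@choice _ _ (fun s f => 0 < s -> critical al q (s * c) f.1 f.2)) => s.
   have [s0|s0] := ltP 0 s; last first.
    by exists (0, 0).
  by have [f fP] := exists_critical al0 q0 (mulr_gt0 s0 c0); exists f.
have sc0 s : 0 < s -> 0 < s * c by move=> s0; rewrite mulr_gt0.
have scE s : s * c = s * t * (1 - t) by rewrite /c mulrA.
pose eta s := symbol al q (s * c) (- (mn s).1).
pose beta s := symbol al q (s * c) (- (mn s).2).
pose gamma s := symbol al q (s * c) ((mn s).1 + (mn s).2).
have etaP s : 0 < s ->
    attained_min [set k | k < 0] (profile al q (s * c)) (eta s).
  by move=> s0; exact: (eta_min q0 (sc0 s s0) (mnP s s0)).
have betaP s : 0 < s -> attained_min [set k | 0 < k < 1]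
    (fun k => - profile al q (s * c) k) (- beta s).
  by move=> s0; exact: (beta_max q0 (sc0 s s0) (mnP s s0)).
have gammaP s : 0 < s ->
    attained_min [set k | 1 < k] (profile al q (s * c)) (gamma s).
  by move=> s0; exact: (gamma_min al0 (sc0 s s0) (mnP s s0)).
have e1 : p ^+ 2 * t ^+ 2 / (4 * a) = q ^+ 2 / (4 * al).
  by rewrite /q /al; field; rewrite !gt_eqF.
have e2 : (1 - t) * (a * (1 - t) + p * t) = al + q by rewrite /q /al; ring.
have eta_bd s : 0 < s -> eta s < - (q ^+ 2 / (4 * al)).
  by move=> s0; exact: (eta_lt al0 q0 (sc0 s s0) (etaP s s0)).
have eta0 s : 0 < s -> eta s < 0.
  move=> /eta_bd/lt_trans; apply.
  by rewrite oppr_lt0 divr_gt0 ?exprn_gt0// mulr_gt0.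
have beta0 s : 0 < s -> 0 < beta s.
  by move=> s0; exact: (beta_gt0 al0 q0 (sc0 s s0) (betaP s s0)).
have G1 s : 0 < s -> Gamma1 a t p s = inC `[beta s, gamma s].
  move=> s0; rewrite /beta /gamma; have := mnP s s0; rewrite scE => H.
  by apply: (Gamma1E _ _ H) => //; rewrite -scE sc0.
have G2 s : 0 < s -> Gamma2 a t p s = inC `]-oo, eta s].
  move=> s0; rewrite /eta; have := mnP s s0; rewrite scE => H.
  by apply: (Gamma2E _ _ H) => //; rewrite -scE sc0.
rewrite e1 e2; split.
  move=> s s0; rewrite G1// G2//.
  split; apply: image_subset => x /=; rewrite !in_itv /=.
    by rewrite andbT => /andP[+ _]; apply: lt_le_trans; exact: beta0.
  by move=> /le_trans; apply; apply: ltW; exact: eta_bd.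
exists eta, beta, gamma; split.
- move=> s s0; split; [exact: eta0|exact: beta0| |exact: G1|exact: G2].
  apply: lt_trans (beta_lt al0 q0 (sc0 s s0) (betaP s s0)) _.
  exact: (gamma_gt al0 q0 (sc0 s s0) (gammaP s s0)).
- split; [exact: (gamma_incr c0 gammaP)
    |exact: (gamma_cvg0 al0 q0 c0 gammaP)|exact: (gamma_cvgy al0 q0 c0 gammaP)].
- split; [by []|exact: (beta_decr c0 betaP)
    |exact: (beta_cvg0 al0 q0 c0 betaP)|exact: (beta_cvgy al0 q0 c0 betaP)].
- split; [by []|exact: (eta_decr c0 etaP)
    |exact: (eta_cvg0 al0 q0 c0 etaP)|exact: (eta_cvgy c0 etaP)].
Qed.
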